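(* Let $d\ge 1$, $m\ge 1$ and $k\ge 2$ be integers, consider the Conway $(m,k)$-game on $\mathbb{Z}^d$, and set $R=\frac{\phi_k+1}{\phi_k-1}$. Then: (i) there exist real numbers $\varepsilon_0,\dots,\varepsilon_{d-1}\in(0,2)$ such that some finite sequence of moves from the initial configuration produces a configuration in which a single cell holds at least $$R^d m - \sum_{i=0}^{d-1} R^i\varepsilon_i$$ checkers; (ii) no finite sequence of moves from the initial configuration produces a configuration in which a single cell holds more than $\lfloor R^d m\rfloor$ checkers.
   Context: The Conway $(m,k)$-game on $\mathbb{Z}^d$: the board is $\mathbb{Z}^d$, and each cell may hold any nonnegative integer number of checkers. Initially every cell $x=(x_1,\dots,x_d)$ with $x_d\le 0$ holds exactly $m$ checkers and every other cell holds none. A move consists of choosing a cell $x$ and a vector $e\in\{\pm e_1,\dots,\pm e_d\}$ (standard unit vectors) such that each of the $k$ cells $x, x+e,\dots,x+(k-1)e$ holds at least one checker; then one checker is removed from each of these $k$ cells and one checker is added to cell $x+ke$. The $k$-nacci constant $\phi_k$ is the unique root $x$ with $|x|\ge1$ of $1+x+\cdots+x^{k-1}-x^k$; it is real and lies in $(1,2)$. *)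

(* Defs.v *)
From mathcomp Require Import all_boot all_order all_algebra.
From mathcomp Require Import boolp classical_sets reals.
From mathcomp Require Import complex ring.

Set Implicit Arguments.
Unset Strict Implicit.
Unset Printing Implicit Defensive.
Import Order.TTheory GRing.Theory Num.Theory.
Local Open Scope ring_scope.

Definition knacci_poly (A : nzRingType) (k : nat) : {poly A} :=
  \sum_(i < k) 'X^i - 'X^k.

(* [xget] returns its default 0 when the set is empty or, in general, some
   element of it; for 2 <= k the set is a singleton, see [knacciP] and
   [knacci_unique] below (the latter covers all complex roots). *)
Definition knacci (R : realType) (k : nat) : R :=
  xget 0 [set x : R | root (knacci_poly R k) x /\ 1 <= `|x|]%classic.

Lemma rootknE (A : comNzRingType) (k : nat) (x : A) :
  root (knacci_poly A k) x = (\sum_(i < k) x ^+ i == x ^+ k).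
Proof.
rewrite rootE /knacci_poly hornerD hornerN hornerXn horner_sum subr_eq0.
by congr (_ == _); apply: eq_bigr => i _; rewrite hornerXn.
Qed.

Lemma geom_cross (A : numDomainType) (k : nat) (x y : A) :
  (0 < k)%N -> 0 < x -> x < y ->
  (\sum_(i < k) y ^+ i) * x ^+ k < (\sum_(i < k) x ^+ i) * y ^+ k.
Proof.
move=> k0 x0 xy; have y0 := lt_trans x0 xy.
rewrite !mulr_suml; apply: ltr_sum => [|i _].
  by apply/hasP; exists (Ordinal k0) => //; rewrite mem_index_enum.
have ik := ltnW (ltn_ord i).
have split_exp u : u ^+ k = u ^+ i * u ^+ (k - i) :> A by rewrite -exprD subnKC.
rewrite [x ^+ k]split_exp [y ^+ k]split_exp mulrCA !ltr_pM2l ?exprn_gt0 //.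
by rewrite ltrXn2r ?nnegrE ?(ltW x0) ?(ltW y0) // subn_eq0 -ltnNge ltn_ord.
Qed.

Lemma knacci_root_unique (C : numClosedFieldType) (k : nat) (z w : C) :
  (2 <= k)%N -> 1 < w -> root (knacci_poly C k) w ->
  1 <= `|z| -> root (knacci_poly C k) z -> z = w.
Proof.
move=> k2 w1; rewrite !rootknE => /eqP hw z1 /eqP hz.
have k0 : (0 < k)%N by apply: leq_trans k2.
have w0 : 0 < w by apply: lt_trans w1.
have tele (x : C) : x ^+ k * (2 - x) = 1 + (x - 1) * (\sum_(i < k) x ^+ i - x ^+ k).
  rewrite [(x - 1) * _]mulrBr -subrX1; set u := x ^+ k; ring.
set r := `|z| in z1 *.
have r0 : 0 < r by apply: lt_le_trans z1.
have er : r ^+ k * `|2 - z| = 1.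
  by rewrite /r -normrX -normrM tele hz subrr mulr0 addr0 normr1.
have eqz : `|2 - z| + r = 2 -> z = r.
  move=> h; have : `|(2 - z) + z| = `|2 - z| + `|z| by rewrite subrK normr_nat -[LHS]h.
  case/normCDeq => t _ [e1 e2].
  have : 2 * t = 2 by rewrite -[X in X * _]h mulrDl -e1 -e2 subrK.
  move=> h2; have t1 : t = 1.
    by apply: (mulfI (_ : 2 != 0 :> C)); rewrite ?pnatr_eq0 // h2 mulr1.
  by rewrite e2 t1 mulr1.
have rS : r ^+ k <= \sum_(i < k) r ^+ i.
  rewrite /r -normrX -hz; apply: le_trans (ler_norm_sum _ _ _) _.
  by apply: ler_sum => i _; rewrite normrX.
have tri : 2 - r <= `|2 - z|.
  by rewrite -[X in X - _](normr_nat C 2); apply: lerB_dist.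
have rw : r >=< w by apply: real_comparable; rewrite gtr0_real.
case: (comparable_ltgtP rw) => [rw1|rw1|rw1].
- move: z1; rewrite le_eqVlt => /orP[/eqP z1|z1].
    have e1 : z = 1.
      rewrite z1 eqz //; have := er; rewrite -z1 expr1n mul1r => ->.
      by rewrite -[1 + 1]/(2%:R).
    move: hz; rewrite e1 expr1n.
    under eq_bigr do rewrite expr1n.
    by rewrite sumr_const card_ord => /eqP; rewrite -[X in _ == X]/(1%:R) eqr_nat => /eqP kk; rewrite kk in k2.
  have : r ^+ k * (2 - r) <= 1.
    by rewrite -[leRHS]er ler_pM2l ?exprn_gt0.
  rewrite tele gerDl pmulr_rle0 ?subr_gt0 // subr_le0 => Sr.
  have Seq : \sum_(i < k) r ^+ i = r ^+ k by apply: le_anti; rewrite Sr rS.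
  by have := geom_cross k0 r0 rw1; rewrite hw Seq mulrC ltxx.
- have := geom_cross k0 w0 rw1; rewrite hw mulrC ltr_pM2l ?exprn_gt0 //.
  by move=> /lt_le_trans/(_ rS); rewrite ltxx.
- rewrite -rw1; apply: eqz.
  have : r ^+ k * `|2 - z| = r ^+ k * (2 - r).
    by rewrite er tele rw1 hw subrr mulr0 addr0.
  by move/mulfI => ->; rewrite ?subrK // expf_neq0 // gt_eqF.
Qed.

Lemma knacciP (R : realType) (k : nat) : (2 <= k)%N ->
  root (knacci_poly R k) (knacci R k) /\ 1 < knacci R k < 2.
Proof.
move=> k2.
have k0 : (0 < k)%N by apply: leq_trans k2.
have at1 : (- knacci_poly R k).[1] < 0.
  rewrite /knacci_poly hornerN hornerD hornerN hornerXn horner_sum expr1n.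
  under eq_bigr do rewrite hornerXn expr1n.
  by rewrite sumr_const card_ord oppr_lt0 subr_gt0 ltr1n.
have at2 : (- knacci_poly R k).[2] = 1.
  rewrite /knacci_poly hornerN hornerD hornerN hornerXn horner_sum.
  under eq_bigr do rewrite hornerXn.
  have := subrX1 (2 : R) k; rewrite -[X in (X - _) * _]/(1 + 1) addrK mul1r => <-.
  by rewrite opprB opprB addrC subrK.
have [|x /andP[x1 x2] rx] := @poly_ivt R (- knacci_poly R k) 1 2 (ler1n _ 2).
  by rewrite (ltW at1) at2 ler01.
rewrite rootN in rx.
have x1' : 1 < x.
  rewrite lt_neqAle x1 andbT; apply/eqP => e; move: at1.
  by rewrite e hornerN (rootP rx) oppr0 ltxx.
have x2' : x < 2.
  rewrite lt_neqAle x2 andbT; apply/eqP => e; move: at2.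
  by rewrite -e hornerN (rootP rx) oppr0 => /eqP; rewrite eq_sym oner_eq0.
have [ry y1] : root (knacci_poly R k) (knacci R k) /\ 1 <= `|knacci R k|.
  rewrite /knacci; apply: (@xgetPex _ 0 [set x : R | root (knacci_poly R k) x /\ 1 <= `|x|]%classic).
  by exists x; split; rewrite // ger0_norm // (le_trans ler01).
have lift y : root (knacci_poly R k) y -> root (knacci_poly R[i] k) y%:C%C.
  rewrite !rootknE => /eqP h; apply/eqP; rewrite -rmorphXn -h rmorph_sum.
  by apply: eq_bigr => i _; rewrite rmorphXn.
have /complexI -> : (knacci R k)%:C%C = x%:C%C.
  apply: (knacci_root_unique k2 _ (lift _ rx) _ (lift _ ry)).
    by rewrite -[1]/(1%:C%C) ltcR.
  by rewrite normc_def /= expr0n addr0 sqrtr_sqr -[1]/(1%:C%C) lecR.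
by rewrite x1' x2'.
Qed.

Lemma knacci_unique (R : realType) (k : nat) (z : R[i]) : (2 <= k)%N ->
  root (knacci_poly R[i] k) z -> 1 <= `|z| -> z = (knacci R k)%:C%C.
Proof.
move=> k2 rz z1; have [rk /andP[k1 _]] := knacciP R k2.
apply: (knacci_root_unique k2) => //; first by rewrite -[1]/(1%:C%C) ltcR.
move: rk; rewrite !rootknE => /eqP h; apply/eqP; rewrite -rmorphXn -h rmorph_sum.
by apply: eq_bigr => i _; rewrite rmorphXn.
Qed.

Definition cell (d : nat) : Type := 'rV[int]_d.

Definition config (d : nat) : Type := cell d -> nat.

(* The last coordinate is the one of index i with i.+1 = d; for 1 <= d there is
   exactly one such i. *)
Definition init_config (d m : nat) : config d := fun x =>
  if [forall i : 'I_d, (i.+1 == d) ==> (x 0 i <= 0)] then m else 0%N.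

Definition unit_dir (d : nat) (e : 'rV[int]_d) : Prop :=
  exists i : 'I_d, e = delta_mx 0 i \/ e = - delta_mx 0 i.

(* As [e] is nonzero, the k + 1 cells involved are pairwise distinct, and the
   truncated subtraction is exact because the jumped cells are nonempty. *)
Definition move (d k : nat) (c c' : config d) : Prop :=
  exists (x : cell d) (e : 'rV[int]_d),
    [/\ unit_dir e,
        forall j : 'I_k, (0 < c (x + e *+ j)%R)%N
      & forall y : cell d,
          c' y = (c y - [exists j : 'I_k, y == x + e *+ j]%R
                  + (y == x + e *+ k)%R)%N].

Inductive reachable (d m k : nat) : config d -> Prop :=
| reachable_init : reachable m k (init_config m)
| reachable_move c c' : reachable m k c -> move k c c' -> reachable m k c'.

(* Main.v *)
Require Import Defs.
From mathcomp Require Import all_boot all_order all_algebra.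
From mathcomp Require Import boolp reals.
From mathcomp Require Import ring lra zify.
Import Order.TTheory GRing.Theory Num.Theory.
Local Open Scope ring_scope.

(* Write phi for the k-nacci constant and q = 1/phi, so q + ... + q^k = 1.
   Upper bound: the total weight of the checkers, for the weight q^|x - t|_1,
   never increases, and the weights of all cells of Z^d sum to R^d.
   Lower bound: checkers can be gathered along one coordinate after the other,
   multiplying the number M of checkers per cell by R up to a loss below 2.
   On each half-line, jumping only when a cell cannot meet the demand put on it
   brings n checkers to the end as soon as n < M / (phi - 1).  Since phi is
   irrational, n = floor (M / (phi - 1)) qualifies, with a loss below 1. *)

(** * Sequences of moves and domination between configurations *)

Definition checker {d : nat} (z : cell d) : config d := fun y => (y == z) : nat.

Inductive moves {d : nat} (k : nat) (c : config d) : config d -> Prop :=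
| moves_refl : moves k c c
| moves_step c' c'' : moves k c c' -> move k c' c'' -> moves k c c''.

Definition dominates {d : nat} (k : nat) (c c' : config d) : Prop :=
  exists2 c'', moves k c c'' & forall y, (c' y <= c'' y)%N.

Lemma moves_trans {d k : nat} {c1 c2 c3 : config d} :
  moves k c1 c2 -> moves k c2 c3 -> moves k c1 c3.
Proof.
move=> m12; elim=> // c c' _ m1 mv; exact: moves_step m1 mv.
Qed.

Lemma reachable_moves {d m k : nat} {c c' : config d} :
  reachable m k c -> moves k c c' -> reachable m k c'.
Proof. by move=> rc; elim=> // c1 c2 _ rc1 mv; apply: reachable_move mv. Qed.

Lemma sum_nat_occupied {I : finType} (P : pred I) :
  (\sum_i P i <= 1)%N -> (\sum_i P i)%N = [exists i, P i].
Proof.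
case: existsP => [[i Pi]|nP] /=.
  by rewrite (bigD1 i) //= Pi add1n ltnS leqn0 => /eqP ->.
by move=> _; apply: big1 => i _; case Pi: (P i) => //; case: nP; exists i.
Qed.

Lemma unit_dirP {d : nat} {e : 'rV[int]_d} :
  unit_dir e -> exists2 i, `|e 0 i| = 1 & forall j, j != i -> e 0 j = 0.
Proof.
case=> i [] ->; exists i; rewrite ?mxE ?eqxx ?normrN //.
  by move=> j /negbTE ne; rewrite mxE ne andbF.
by move=> j /negbTE ne; rewrite !mxE ne andbF oppr0.
Qed.

Lemma unit_dir_mulrn_inj {d : nat} {e : 'rV[int]_d} (x : cell d) :
  unit_dir e -> injective (fun n : nat => x + e *+ n).
Proof.
case/unit_dirP=> i e1 _ a b /addrI /(congr1 (fun v : 'rV_d => v 0 i)).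
rewrite !mulmxnE => /(congr1 Num.norm); rewrite !normrMn e1.
by move/eqP; rewrite eqr_nat => /eqP.
Qed.

Lemma sum_checkers {d k : nat} {e : 'rV[int]_d} (x y : cell d) :
  unit_dir e ->
  (\sum_(j < k) checker (x + e *+ j)%R y)%N = [exists j : 'I_k, y == x + e *+ j].
Proof.
move=> ue; apply: (@sum_nat_occupied _ (fun j : 'I_k => y == x + e *+ j)).
have [/existsP[j /eqP yj]|] := boolP [exists j : 'I_k, y == x + e *+ j].
  rewrite (bigD1 j) //= yj eqxx big1 // => i ne; apply/eqP; rewrite eqb0.
  apply: contra ne => /eqP /(unit_dir_mulrn_inj x ue) ij.
  by apply/eqP/val_inj.
rewrite negb_exists => /forallP nP; rewrite big1 // => j _.
by rewrite (negbTE (nP j)).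
Qed.

(** Extra checkers never block a move, and the truncated subtraction commutes with adding [f]
    because it only affects occupied cells. *)
Lemma move_addr {d k : nat} {c c' : config d} (f : config d) :
  move k c c' -> move k (fun y => c y + f y)%N (fun y => c' y + f y)%N.
Proof.
case=> x [e [ue occ mv]]; exists x, e; split=> // [j|y].
  by rewrite addn_gt0 occ.
rewrite mv; case: existsP => [[j /eqP yj]|_]; last lia.
by have := occ j; rewrite -yj; lia.
Qed.

Lemma moves_addr {d k : nat} {c c' : config d} (f : config d) :
  moves k c c' -> moves k (fun y => c y + f y)%N (fun y => c' y + f y)%N.
Proof.
elim=> [|c1 c2 _ IH mv]; first exact: moves_refl.
exact: moves_step IH (move_addr f mv).
Qed.

Lemma dominates_le {d k : nat} {c c' : config d} :
  (forall y, (c' y <= c y)%N) -> dominates k c c'.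
Proof. by exists c => //; apply: moves_refl. Qed.

Lemma dominates_addr {d k : nat} {c c' : config d} (f : config d) :
  dominates k c c' ->
  dominates k (fun y => c y + f y)%N (fun y => c' y + f y)%N.
Proof.
case=> b mb le; exists (fun y => b y + f y)%N; first exact: moves_addr.
by move=> y; rewrite leq_add2r.
Qed.

Lemma dominates_trans {d k : nat} {c1 c2 c3 : config d} :
  dominates k c1 c2 -> dominates k c2 c3 -> dominates k c1 c3.
Proof.
move=> [b mb leb] [a ma lea].
(* The surplus of [b] over [c2] is carried untouched through the second sequence of moves. *)
exists (fun y => a y + (b y - c2 y))%N.
  apply: (moves_trans mb).
  rewrite [b in moves _ b _](_ : _ = fun y => c2 y + (b y - c2 y))%N.
    exact: moves_addr.
  by apply/funext => y; rewrite subnKC.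
by move=> y; apply: leq_trans (lea y) _; rewrite leq_addr.
Qed.

Lemma dominates_add {d k : nat} {c1 c1' c2 c2' : config d} :
  dominates k c1 c1' -> dominates k c2 c2' ->
  dominates k (fun y => c1 y + c2 y)%N (fun y => c1' y + c2' y)%N.
Proof.
move=> h1 h2; apply: (dominates_trans (dominates_addr c2 h1)).
have := dominates_addr c1' h2.
by congr dominates; apply/funext => y; rewrite addnC.
Qed.

Lemma dominates_sum {d k : nat} {I : Type} (r : seq I) (F G : I -> config d) :
  (forall i, dominates k (F i) (G i)) ->
  dominates k (fun y => \sum_(i <- r) F i y)%N (fun y => \sum_(i <- r) G i y)%N.
Proof.
move=> FG; elim: r => [|i r IH].
  by apply: dominates_le => y; rewrite !big_nil.
have := dominates_add (FG i) IH.
by congr dominates; apply/funext => y; rewrite big_cons.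
Qed.

Lemma dominates_mul {d k : nat} (n : nat) {c c' : config d} :
  dominates k c c' ->
  dominates k (fun y => n * c y)%N (fun y => n * c' y)%N.
Proof.
move=> cc'; have := @dominates_sum d k _ (iota 0 n) (fun=> c) (fun=> c') (fun=> cc').
congr dominates; apply/funext => y;
  by rewrite big_const_seq count_predT size_iota iter_addn addn0 mulnC.
Qed.

(** * Jumps along a line *)

Lemma dominates_jump {d k : nat} {e : 'rV[int]_d} (x : cell d) :
  unit_dir e ->
  dominates k (fun y => \sum_(j < k) checker (x + e *+ j)%R y)%N
    (checker (x + e *+ k)).
Proof.
move=> ue; exists (checker (x + e *+ k)) => //.
apply: moves_step (moves_refl _ _) _; exists x, e; split=> // [j|y].
  by rewrite sum_checkers // lt0b; apply/existsP; exists j.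
by rewrite sum_checkers // subnn.
Qed.

(** This is [n] repetitions of the jump landing on [x]. The jumped cells are listed outwards from
    [x], and the factor [(i < k)] pads the sum to length [N], so that it can be added to the sums
    over a line. *)
Lemma dominates_jump_mul {d k : nat} {e : 'rV[int]_d} (n N : nat) (x : cell d) :
  unit_dir e -> (k <= N)%N ->
  dominates k (fun y => \sum_(i < N) n * (i < k) * checker (x - e - e *+ i)%R y)%N
    (fun y => n * checker x y)%N.
Proof.
move=> ue kN; have := dominates_mul n (@dominates_jump d k e (x - e *+ k) ue).
rewrite subrK; congr dominates; apply/funext => y.
rewrite (big_ord_widen _ (fun i => checker (x - e *+ k + e *+ i)%R y) kN) big_distrr /=.
rewrite -(big_ord_widen _ (fun i => n * checker (x - e *+ k + e *+ i)%R y)%N kN).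
under [RHS]eq_bigr => i _ do rewrite -mulnA.
rewrite [RHS](bigID (fun i : 'I_N => i < k)%N) /= [X in (_ + X)%N]big1 ?addn0; last first.
  by move=> i /negbTE ->; rewrite mul0n muln0.
under [RHS]eq_bigr => i ik do rewrite ik mul1n.
rewrite -(big_ord_widen _ (fun i => n * checker (x - e - e *+ i)%R y)%N kN).
rewrite (reindex_inj rev_ord_inj) /=; apply: eq_bigr => i _.
by congr (_ * checker _ _)%N; rewrite mulrnBr // -addrA addKr mulrS opprD addrA.
Qed.

(* Covering [D 0] checkers demanded at distance 0 when [M] are present there:
   the other [D 0 - M] must come from jumps over the next [k] cells. *)
Definition shift_demand (k M : nat) (D : nat -> nat) : nat -> nat :=
  fun i => (D i.+1 + (D 0 - M) * (i < k))%N.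

(** Induction on [J]: the demand shifted past [x] is met first, starting from [x - e], and then
    [D 0 - M] jumps land on [x]. After [J] cells the stock suffices everywhere; the last of these
    cells may still use the next [k] cells, hence [J + k <= N]. *)
Lemma dominates_line {d k : nat} {e : 'rV[int]_d} (M : nat) (D : nat -> nat)
    (J N : nat) (x : cell d) :
  unit_dir e -> (J + k <= N)%N ->
  (forall i, iter J (shift_demand k M) D i <= M)%N ->
  dominates k (fun y => \sum_(i < N) M * checker (x - e *+ i)%R y)%N
    (fun y => \sum_(i < N) D i * checker (x - e *+ i)%R y)%N.
Proof.
move=> ue; elim: J D N x => [|J IH] D N x.
  move=> _ DM; apply: dominates_le => y; apply: leq_sum => i _.
  by rewrite leq_mul2r DM orbT.
case: N => // N; rewrite addSn ltnS iterSr => JN DM.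
have kN : (k <= N)%N by apply: leq_trans JN; rewrite leq_addl.
have recl (F : nat -> nat) y : (\sum_(i < N.+1) F i * checker (x - e *+ i)%R y =
    F 0 * checker x y + \sum_(i < N) F i.+1 * checker (x - e - e *+ i)%R y)%N.
  rewrite big_ord_recl mulr0n subr0; congr addn.
  by apply: eq_bigr => i _; rewrite lift0 mulrS opprD addrA.
have tail := dominates_add (dominates_le (fun y => leqnn (M * checker x y)%N))
  (IH _ N (x - e) JN DM).
apply: dominates_trans (dominates_trans (dominates_le _) tail) _ => [y|].
  by rewrite recl.
(* Of the shifted demand, the part [D i.+1] stays in place and the part [(D 0 - M) * (i < k)] is
   consumed by the jumps into [x]. *)
apply: dominates_trans (dominates_le _) (dominates_trans (dominates_addr
    (fun y => M * checker x y + \sum_(i < N) D i.+1 * checker (x - e - e *+ i)%R y)%N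
    (dominates_jump_mul (D 0 - M)%N N x ue kN)) (dominates_le _)) => y.
  rewrite addnCA leq_add2l addnC -big_split /=.
  by apply: leq_sum => i _; rewrite -mulnDl.
rewrite (recl D) addnA -mulnDl leq_add2r leq_mul2r.
by rewrite addnC -leq_subLR leqnn orbT.
Qed.

(** * Arithmetic of the k-nacci constant *)

(* For phi = p / n, the equation phi^k (2 - phi) = 1 would be the one excluded here. *)
Lemma expn_mul_sub_neq (k n p : nat) :
  (0 < k)%N -> (0 < n < p)%N -> (p ^ k * (n.*2 - p) <> n ^ k.+1)%N.
Proof.
move=> k0 /andP[n0 np].
have g0 : (0 < gcdn p n)%N by rewrite gcdn_gt0 n0 orbT.
have pE := divnK (dvdn_gcdl p n); have nE := divnK (dvdn_gcdr p n).
move: g0 pE nE; set g := gcdn p n; set p' := (p %/ g)%N; set n' := (n %/ g)%N.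
move=> g0 pE nE.
have co : coprime p' n'.
  by rewrite /coprime -(eqn_pmul2r g0) mul1n muln_gcdl pE nE.
rewrite -pE -nE (_ : (n' * g).*2 - p' * g = (n'.*2 - p') * g)%N; last first.
  by rewrite mulnBl -!muln2 mulnAC.
rewrite !expnMn mulnACA -expnSr => /eqP.
rewrite eqn_pmul2r ?expn_gt0 ?g0 // => /eqP e.
(* By [e], [p' ^ k] divides [n' ^ k.+1]; coprimality then forces [p' = 1], and [n' < p'] leaves only
   [n' = 0]. *)
have : coprime (p' ^ k) (n' ^ k.+1) by rewrite coprimeXl // coprimeXr.
rewrite -e /coprime gcdnMr -(exp1n k) eqn_exp2r // => /eqP p1.
by move: np; rewrite -pE -nE p1 ltn_pmul2r // ltnS leqn0 => /eqP n'0; rewrite -nE n'0 in n0.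
Qed.

Lemma knacci_sum {R : realType} {k : nat} :
  (2 <= k)%N -> \sum_(i < k) knacci R k ^+ i = knacci R k ^+ k.
Proof. by move=> k2; have [] := knacciP R k2; rewrite rootknE => /eqP. Qed.

Lemma knacci_inv_sum {R : realType} {k : nat} :
  (2 <= k)%N -> \sum_(i < k) (knacci R k)^-1 ^+ i.+1 = 1.
Proof.
move=> k2; have [_ /andP[p1 _]] := knacciP R k2.
have pn0 : knacci R k != 0 by rewrite gt_eqF // (lt_trans ltr01).
have pk0 : knacci R k ^+ k != 0 by rewrite expf_neq0.
apply: (mulfI pk0); rewrite mulr1 -[RHS]knacci_sum // big_distrr /=.
rewrite (reindex_inj rev_ord_inj) /=; apply: eq_bigr => i _.
by rewrite subnSK // exprVn -expfB_cond ?(negbTE pn0) ?leq_subr // subKn // ltnW.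
Qed.

(** Equality would give phi = (M + n) / n, and multiplying phi^k (2 - phi) = 1 by n^(k+1) would
    contradict [expn_mul_sub_neq]. Since phi < 2, one has [M < n], so the natural subtraction there
    is exact. *)
Lemma knacci_ratio_neq_nat {R : realType} {k : nat} (M n : nat) :
  (2 <= k)%N -> (0 < M)%N -> M%:R / (knacci R k - 1) != n%:R.
Proof.
move=> k2 M0; have [_ /andP[p1 p2]] := knacciP R k2.
have := knacci_sum (R := R) k2; set p := knacci R k in p1 p2 *.
move=> sp; apply/eqP => e.
have p10 : 0 < p - 1 by rewrite subr_gt0.
have e1 : M%:R = n%:R * (p - 1) by rewrite -e divfK // gt_eqF.
have MR : 0 < M%:R :> R by rewrite ltr0n.
have nR : 0 < n%:R :> R by rewrite -(pmulr_lgt0 _ p10) -e1.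
have Mn : (M < n)%N.
  by rewrite -(ltr_nat R) e1 gtr_pMr //; lra.
have pk : p ^+ k * (2 - p) = 1.
  have := subrX1 p k; rewrite sp; set u := p ^+ k => h.
  have -> : u * (2 - p) = u - (p - 1) * u by ring.
  by rewrite -h; ring.
apply: (@expn_mul_sub_neq k n (M + n)); [lia|lia|].
apply/eqP; rewrite -(eqr_nat R) natrM !natrX natrB; last by lia.
rewrite -muln2 natrM natrD e1 exprS.
have -> : n%:R * (p - 1) + n%:R = n%:R * p by ring.
rewrite exprMn; apply/eqP; transitivity (n%:R * n%:R ^+ k * (p ^+ k * (2 - p))).
  by set u := _ ^+ k; set v := _ ^+ k; ring.
by rewrite pk mulr1.
Qed.

(** * Evolution of the pending demands *)

Lemma iter_demand_eq0 {k : nat} (M n J : nat) {i : nat} :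
  (k <= i)%N -> iter J (shift_demand k M) (fun i => n * (i < k))%N i = 0.
Proof.
elim: J i => [|J IH] i ki /=; first by rewrite ltnNge ki muln0.
by rewrite /shift_demand IH ?(leqW ki) // ltnNge ki muln0.
Qed.

(** Demands stay nonincreasing in the distance, so only the one at distance 0 has to be compared
    with [M]. *)
Lemma iter_demand_homo (k M n J i : nat) :
  (iter J (shift_demand k M) (fun i => n * (i < k)) i <=
   iter J (shift_demand k M) (fun i => n * (i < k)) 0)%N.
Proof.
set D := iter J _ _; have step j : (D j.+1 <= D j)%N.
  rewrite {}/D; elim: J j => [|J IH] j /=; first by rewrite leq_mul2l; lia.
  by rewrite /shift_demand leq_add // leq_mul2l; lia.
by elim: i => // i; apply: leq_trans.
Qed.

(** Advancing by one cell divides every weight by [q]. Replacing a checker by one on each of the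
    next [k] cells preserves weight, as q + ... + q^k = 1, so only the [M] checkers supplied on the
    spot are lost. The condition [D k = 0] removes the boundary term. *)
Lemma weight_shift_demand {R : fieldType} {k M : nat} {D : nat -> nat} {q : R} :
  q != 0 -> \sum_(i < k) q ^+ i.+1 = 1 -> (M <= D 0)%N -> D k = 0%N ->
  \sum_(i < k) (shift_demand k M D i)%:R * q ^+ i.+1 =
  q^-1 * \sum_(i < k) (D i)%:R * q ^+ i.+1 - M%:R.
Proof.
move=> q0 q1 MD Dk.
have -> : q^-1 * (\sum_(i < k) (D i)%:R * q ^+ i.+1) = \sum_(i < k) (D i)%:R * q ^+ i.
  rewrite big_distrr /=; apply: eq_bigr => i _.
  by rewrite exprS mulrCA mulKf.
have -> : \sum_(i < k) (shift_demand k M D i)%:R * q ^+ i.+1 =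
   \sum_(i < k) (D i.+1)%:R * q ^+ i.+1 + ((D 0)%:R - M%:R).
  rewrite -[X in _ + X]mulr1 -[X in _ + _ * X]q1 big_distrr -big_split /=; apply: eq_bigr => i _.
  by rewrite /shift_demand ltn_ord muln1 natrD natrB // mulrDl.
rewrite addrA; congr (_ - _).
case: k Dk q1 => [|k] Dk; first by rewrite big_ord0 => /esym/eqP; rewrite oner_eq0.
move=> _; rewrite big_ord_recr /= Dk mul0r addr0 [RHS]big_ord_recl mulr1 addrC.
by congr +%R.
Qed.

Lemma bernoulli {R : realDomainType} (x : R) (n : nat) :
  1 <= x -> 1 + n%:R * (x - 1) <= x ^+ n.
Proof.
move=> x1; elim: n => [|n IH]; first by rewrite mul0r addr0.
rewrite exprS; apply: le_trans (_ : x * (1 + n%:R * (x - 1)) <= _).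
  rewrite -natr1 -subr_ge0 (_ : _ - _ = n%:R * (x - 1) ^+ 2); last by ring.
  by rewrite mulr_ge0 // sqr_ge0.
by rewrite ler_pM2l //; apply: lt_le_trans x1.
Qed.

(* As long as a jump is needed, the weight of the pending demands evolves by
   [W' = W / q - M], so it would become negative if the process did not stop. *)
Lemma demand_drains {R : realType} (k M n : nat) (q : R) :
  0 < q < 1 -> \sum_(i < k) q ^+ i.+1 = 1 -> n%:R < M%:R / (q^-1 - 1) ->
  exists J, forall i,
    (iter J (shift_demand k M) (fun i => n * (i < k)) i <= M)%N.
Proof.
move=> /andP[q0 q1] qs nM.
pose D J := iter J (shift_demand k M) (fun i => n * (i < k))%N.
have [[J DJ]|nex] := pselect (exists J, (D J 0 <= M)%N).
  by exists J => i; apply: leq_trans (iter_demand_homo _ _ _ _ _) DJ.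
have MD J : (M <= D J 0)%N.
  by rewrite leqNgt; apply/negP => lt; apply: nex; exists J; apply: ltnW.
pose W J := \sum_(i < k) (D J i)%:R * q ^+ i.+1.
have p1 : 1 < q^-1 by rewrite invf_gt1.
(* [C] is the fixed point of W' = p W - M, and the initial weight is [n < C]; the gap to [C] is thus
   multiplied by [p] at each step. *)
set p := q^-1 in p1 nM *; set C := M%:R / (p - 1) in nM *.
have CE : C * (p - 1) = M%:R by rewrite divfK // gt_eqF // subr_gt0.
have WE J : W J - C = p ^+ J * (n%:R - C).
  elim: J => [|j IH].
    rewrite mul1r; congr (_ - _); rewrite -[RHS]mulr1 -[X in _ = _ * X]qs big_distrr.
    by apply: eq_bigr => i _; rewrite /D /= ltn_ord muln1.
  have := weight_shift_demand (lt0r_neq0 q0) qs (MD j) (iter_demand_eq0 M n j (leqnn k)).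
  rewrite [LHS]/= -[LHS]/(W j.+1) => ->.
  by rewrite -/(W j) -/p exprS -mulrA -IH -CE; ring.
have W0 J : 0 <= W J.
  by apply: sumr_ge0 => i _; rewrite mulr_ge0 // exprn_ge0 // ltW.
have Cn : 0 < (C - n%:R) * (p - 1) by rewrite mulr_gt0 // subr_gt0.
have C0 : 0 <= C / ((C - n%:R) * (p - 1)).
  by rewrite divr_ge0 ?(ltW Cn) // (le_trans _ (ltW nM)).
(* With [b * ((C - n) * (p - 1)) > C], Bernoulli's inequality gives [p ^+ b * (C - n) > C], that is
   [W b < 0]. *)
have := archi_boundP C0; set b := Num.bound _; rewrite ltr_pdivrMr // => lt.
have := W0 b; have := WE b; have := bernoulli _ b (ltW p1).
set u := p ^+ b => h1 h2 h3; exfalso.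
have Cn' : 0 < C - n%:R by rewrite subr_gt0.
have := ler_wpM2r (ltW Cn') h1.
move: lt h2 h3 Cn'; set w := W b; set j := b%:R; nra.
Qed.

(** * Gathering a whole line into one cell *)

(** The order (zero, positive, negative) mirrors the splitting of a line into its centre and two
    half-lines. *)
Definition centered_ints (N : nat) : seq int :=
  0 :: [seq Posz i.+1 | i <- iota 0 N] ++ [seq Negz i | i <- iota 0 N].

Arguments centered_ints : simpl never.

Lemma mem_centered_ints (N : nat) (z : int) :
  (z \in centered_ints N) = (`|z| <= N)%N.
Proof.
rewrite inE mem_cat; case: z => [[|n]|n] //=.
  rewrite (_ : (Posz n.+1 \in map Negz _) = false) ?orbF; last by apply/mapP=> -[].
  rewrite (mem_map (f := fun i => Posz i.+1)); last by move=> i j [].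
  by rewrite mem_iota.
rewrite (_ : (Negz n \in map _ _) = false) /=; last by apply/mapP=> -[].
by rewrite mem_map ?mem_iota // => i j [].
Qed.

Lemma centered_ints_uniq (N : nat) : uniq (centered_ints N).
Proof.
rewrite /centered_ints /= cat_uniq !map_inj_uniq ?iota_uniq; try by move=> i j [].
rewrite mem_cat negb_or andbT -!andbA; apply/and4P; split=> //.
- by apply/mapP=> -[].
- by apply/mapP=> -[].
- by apply/hasPn => _ /mapP[i _ ->]; apply/mapP=> -[].
Qed.

(** The [M] checkers already at the centre, plus floor (M / (phi - 1)) brought from each side. *)
Definition gather (R : realType) (k M : nat) : nat :=
  (M + (Num.truncn (M%:R / (knacci R k - 1) : R)).*2)%N.

(** Since R M = M + 2 M / (phi - 1), the loss is twice the fractional part of M / (phi - 1), which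
    is nonzero by irrationality. *)
Lemma gather_loss {R : realType} {k M : nat} :
  (2 <= k)%N -> (0 < M)%N ->
  0 < (knacci R k + 1) / (knacci R k - 1) * M%:R - (gather R k M)%:R < 2.
Proof.
move=> k2 M0; have [_ /andP[p1 p2]] := knacciP R k2.
have p10 : 0 < knacci R k - 1 by rewrite subr_gt0.
have ge0 : 0 <= M%:R / (knacci R k - 1) by rewrite divr_ge0 // ltW.
have /andP[] := truncn_itv ge0; rewrite le_eqVlt eq_sym.
rewrite (negbTE (knacci_ratio_neq_nat _ _ k2 M0)) /= /gather -muln2 natrD natrM -natr1.
have -> : (knacci R k + 1) / (knacci R k - 1) * M%:R =
    M%:R + 2 * (M%:R / (knacci R k - 1)).
  by field; rewrite gt_eqF.
by move=> lo hi; lra.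
Qed.

(** To receive [n] jumps, [x] demands [n] checkers on each of the [k] nearest cells of the
    half-line; [demand_drains] shows that this demand dies out. The bound [N0] is uniform in [x] and
    [e], so that many parallel lines can be treated at once. *)
Lemma dominates_ray {R : realType} {k M : nat} :
  (2 <= k)%N -> (0 < M)%N ->
  exists N0, forall d (e : 'rV[int]_d) N (x : cell d), unit_dir e -> (N0 <= N)%N ->
  dominates k (fun y => \sum_(i < N) M * checker (x - e *+ i.+1)%R y)%N
    (fun y => Num.truncn (M%:R / (knacci R k - 1) : R) * checker x y)%N.
Proof.
move=> k2 M0; have [_ /andP[p1 p2]] := knacciP R k2.
have p0 : 0 < knacci R k by apply: lt_trans p1.
set n := Num.truncn _.
have ge0 : 0 <= M%:R / (knacci R k - 1) by rewrite divr_ge0 // ltW // subr_gt0.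
have nM : n%:R < M%:R / ((knacci R k)^-1^-1 - 1).
  have /andP[le _] := truncn_itv ge0; rewrite invrK lt_neqAle le andbT eq_sym.
  exact: knacci_ratio_neq_nat.
have q01 : 0 < (knacci R k)^-1 < 1 by rewrite invr_gt0 p0 invf_lt1.
have [J DJ] := demand_drains _ _ _ _ q01 (knacci_inv_sum k2) nM.
exists (J + k)%N => d e N x ue JN.
have := dominates_line _ _ _ _ (x - e) ue JN DJ => h.
apply: dominates_trans (dominates_trans (dominates_le _) h) _ => [y|].
  by apply: leq_sum => i _; rewrite mulrS opprD addrA.
by apply: dominates_jump_mul => //; apply: leq_trans JN; rewrite leq_addl.
Qed.

Lemma unit_dirN {d : nat} {e : 'rV[int]_d} : unit_dir e -> unit_dir (- e).
Proof. by case=> i [] ->; exists i; [right|left; rewrite opprK]. Qed.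

Lemma dominates_gather {R : realType} {k M : nat} :
  (2 <= k)%N -> (0 < M)%N ->
  exists N0, forall d (e : 'rV[int]_d) N (x : cell d), unit_dir e -> (N0 <= N)%N ->
  dominates k (fun y => \sum_(z <- centered_ints N) M * checker (x + e *~ z)%R y)%N
    (fun y => gather R k M * checker x y)%N.
Proof.
move=> k2 M0; have [N0 ray] := dominates_ray (R := R) k2 M0.
exists N0 => d e N x ue N0N.
have h := dominates_add (ray d _ N x (unit_dirN ue) N0N) (ray d e N x ue N0N).
have := dominates_addr (fun y => M * checker x y)%N h.
congr dominates; apply/funext => y.
  rewrite big_cons big_cat !big_map mulr0z addr0 /= addnC -[N in iota 0 N]subn0.
  rewrite -/(index_iota 0 N) !big_mkord; congr (_ + (_ + _))%N.
  by apply: eq_bigr => i _; rewrite mulNrn opprK.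
by rewrite /gather mulnDl -muln2 addnC; lia.
Qed.

(** * Boxes and gathering in all coordinates *)

(** Indexing by a natural number lets [box] recurse on [r] without a proof of [r < d]; the vector is
    zero when [d <= r]. *)
Definition axis (d r : nat) : 'rV[int]_d := \row_j (j == r :> nat)%:R.

Lemma axis_unit_dir {d r : nat} : (r < d)%N -> unit_dir (axis d r).
Proof.
move=> rd; exists (Ordinal rd); left; apply/rowP => j; rewrite !mxE eqxx.
by congr (_%:R).
Qed.

Lemma axis_mulz {d : nat} (r : nat) (z : int) (i : 'I_d) :
  (axis d r *~ z) 0 i = if i == r :> nat then z else 0.
Proof.
rewrite -scaler_int !mxE; case: eqP; rewrite ?mulr1 ?mulr0 //.
by rewrite intz.
Qed.

(* The cells within distance [N] of [t] in each of the first [r] coordinates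
   and agreeing with [t] in the others. *)
Fixpoint box {d : nat} (N r : nat) (t : cell d) : seq (cell d) :=
  if r is r'.+1 then
    [seq x + axis d r' *~ z | x <- box N r' t, z <- centered_ints N]
  else [:: t].

Lemma mem_boxP {d N r : nat} {t x : cell d} : (r <= d)%N ->
  reflect (forall i : 'I_d, (`|(x 0 i - t 0 i)%R| <= (i < r) * N)%N)
    (x \in box N r t).
Proof.
elim: r x => [|r IH] x rd.
  rewrite inE; apply: (iffP eqP) => [-> i|h]; first by rewrite subrr.
  by apply/rowP => i; have := h i; rewrite ltn0 mul0n leqn0 absz_eq0 subr_eq0 => /eqP.
apply: (iffP allpairsP) => [[[y z] /= [yb zb ->]] i|h].
  have := (IH y (ltnW rd) yb) i; rewrite mxE axis_mulz.
  rewrite mem_centered_ints in zb; rewrite ltnS [(i <= r)%N]leq_eqVlt.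
  case: eqP => [->|] /=; last by rewrite addr0.
  by rewrite ltnn mul0n leqn0 absz_eq0 subr_eq0 mul1n => /eqP ->; rewrite [_ + z]addrC addrK.
pose j := Ordinal rd.
exists (x - axis d r *~ (x 0 j - t 0 j), x 0 j - t 0 j); split=> /=.
- apply/IH => [|i]; first exact: ltnW.
  have := h i; rewrite mxE [(- (_ : cell d)) 0 i]mxE axis_mulz ltnS [(i <= r)%N]leq_eqVlt.
  case: eqP => [ir|] /=; last by rewrite subr0.
  by have -> : i = j by [apply/val_inj]; rewrite subKr subrr.
- by have := h j; rewrite mem_centered_ints ltnSn mul1n.
- by rewrite subrK.
Qed.

(** Cells of [box N r t] still have the coordinate [r] of [t], so the displacement [z] along
    [axis d r], and then the base cell, can be read off. *)
Lemma box_uniq {d : nat} (N r : nat) (t : cell d) : (r <= d)%N -> uniq (box N r t).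
Proof.
elim: r => [|r IH] rd; [by []|apply: allpairs_uniq].
- exact: IH (ltnW rd).
- exact: centered_ints_uniq.
pose j := Ordinal rd.
have tj x : x \in box N r t -> x 0 j = t 0 j.
  move/(mem_boxP (ltnW rd))/(_ j).
  by rewrite ltnn mul0n leqn0 absz_eq0 subr_eq0 => /eqP.
have st_box p : p \in [seq (x, z) | x <- box N r t, z <- centered_ints N] ->
    p.1 \in box N r t by case/allpairsP=> -[a b] /= [? _ ->].
move=> [a b] [a' b'] /st_box /= ab /st_box /= ab' /= e.
have : (a + axis d r *~ b) 0 j = (a' + axis d r *~ b') 0 j by rewrite e.
rewrite [LHS]mxE [RHS]mxE !axis_mulz eqxx (tj _ ab) (tj _ ab') => /addrI bb'.
by move: e; rewrite bb' => /addIr ->.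
Qed.

Lemma gather_gt0 {R : realType} {k M : nat} : (0 < M)%N -> (0 < gather R k M)%N.
Proof. by move=> M0; rewrite addn_gt0 M0. Qed.

Lemma iter_gather_gt0 {R : realType} {k M : nat} (r : nat) :
  (0 < M)%N -> (0 < iter r (gather R k) M)%N.
Proof. by move=> M0; elim: r => //= r; apply: gather_gt0. Qed.

(** The last direction is collapsed first: each cell of the smaller box gathers its own line, and
    induction applies with [gather R k M] in place of [M]. *)
Lemma dominates_box {R : realType} {d k M : nat} (r : nat) :
  (2 <= k)%N -> (0 < M)%N -> (r <= d)%N ->
  exists N0, forall N (t : cell d), (N0 <= N)%N ->
  dominates k (fun y => \sum_(x <- box N r t) M * checker x y)%N
    (fun y => iter r (gather R k) M * checker t y)%N.
Proof.
move=> k2; elim: r M => [|r IH] M M0 rd.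
  by exists 0%N => N t _; apply: dominates_le => y; rewrite big_seq1.
have [N1 line] := dominates_gather (R := R) k2 M0.
have [N2 cols] := IH _ (gather_gt0 (R := R) (k := k) M0) (ltnW rd).
exists (maxn N1 N2) => N t; rewrite geq_max => /andP[N1N N2N].
rewrite iterSr; apply: dominates_trans _ (cols _ _ N2N).
have := dominates_sum (box N r t) _ _ (fun x => line d _ N x (axis_unit_dir rd) N1N).
by congr dominates; apply/funext => y; rewrite big_allpairs_dep.
Qed.

Lemma sum_pred1_uniq {T : eqType} (s : seq T) (y : T) :
  uniq s -> (\sum_(x <- s) (y == x))%N = (y \in s).
Proof.
elim: s => [|x s IH] /=; first by rewrite big_nil.
by case/andP=> xs us; rewrite big_cons IH // inE; case: eqP => [->|//]; rewrite (negbTE xs).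
Qed.

Lemma reachable_gather {R : realType} {d k m : nat} :
  (2 <= k)%N -> (0 < m)%N ->
  exists (c : config d) (t : cell d),
    reachable m k c /\ (iter d (gather R k) m <= c t)%N.
Proof.
move=> k2 m0; have [N h] := dominates_box (R := R) (d := d) d k2 m0 (leqnn d).
(* At depth [N] the box of radius [N] around [t] lies in the initially filled half-space. *)
pose t : cell d := const_mx (- N%:R).
have le_init y : (\sum_(x <- box N d t) m * checker x y <= init_config m y)%N.
  rewrite -big_distrr /= sum_pred1_uniq ?box_uniq // /init_config.
  case: (mem_boxP (leqnn d)) => [yb|_]; last by rewrite muln0.
  rewrite ifT ?muln1 //; apply/forallP => i; apply/implyP => _.
  by have := yb i; rewrite ltn_ord mxE; lia.
have [c mv le] := dominates_trans (dominates_le le_init) (h N t (leqnn N)).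
exists c, t; split; first exact: reachable_moves (reachable_init _ _ _) mv.
by have := le t; rewrite /checker eqxx muln1.
Qed.

(** * Weights and the upper bound *)

Definition norm1 {d : nat} (x : cell d) : nat := (\sum_i `|(x 0 i)%R|)%N.

Lemma norm1D {d : nat} (x y : cell d) : (norm1 (x + y)%R <= norm1 x + norm1 y)%N.
Proof.
rewrite /norm1 -big_split /=; apply: leq_sum => i _; by rewrite mxE -lez_nat PoszD !abszE ler_normD.
Qed.

Lemma norm1_unit_dir {d : nat} {e : 'rV[int]_d} (n : nat) :
  unit_dir e -> norm1 (e *+ n) = n.
Proof.
case/unit_dirP => i e1 e0; rewrite /norm1 (bigD1 i) //= big1 ?addn0.
  by rewrite mulmxnE; apply/eqP; rewrite -eqz_nat abszE normrMn e1 natz.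
by move=> j ne; rewrite mulmxnE e0 // mul0rn.
Qed.

Lemma norm1N {d : nat} (x : cell d) : norm1 (- x) = norm1 x.
Proof. by apply: eq_bigr => i _; rewrite mxE abszN. Qed.

(** The cell [x + e *+ j] is at distance [k - j] from the landing cell, so by the triangle
    inequality its weight is at least q^(k-j) times that of the landing cell; these factors sum to
    1. *)
Lemma weight_jump {R : realType} {d k : nat} {q : R} {e : 'rV[int]_d} (x : cell d) :
  0 < q < 1 -> \sum_(i < k) q ^+ i.+1 = 1 -> unit_dir e ->
  q ^+ norm1 (x + e *+ k) <= \sum_(j < k) q ^+ norm1 (x + e *+ j).
Proof.
move=> /andP[q0 q1] qs ue; rewrite -[leLHS]mulr1 -qs big_distrr /=.
rewrite (reindex_inj rev_ord_inj); apply: ler_sum => j _ /=.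
rewrite -exprD subnSK // ler_wiXn2l ?ltW //.
have -> : x + e *+ j = (x + e *+ k) - e *+ (k - j).
  by rewrite mulrnBr ?(ltnW (ltn_ord j)) // -addrA subKr.
by apply: leq_trans (norm1D _ _) _; rewrite norm1N norm1_unit_dir.
Qed.

(** The weight factors over coordinates, and each contributes at most 1 + 2 q / (1 - q) = (1 + q) /
    (1 - q). *)
Lemma sum_box_weight {R : realType} {d : nat} {q : R} (N r : nat) (t : cell d) :
  0 < q < 1 -> (r <= d)%N ->
  \sum_(x <- box N r t) q ^+ norm1 (x - t) <= ((1 + q) / (1 - q)) ^+ r.
Proof.
move=> /andP[q0 q1]; have q10 : 0 < 1 - q by rewrite subr_gt0.
elim: r => [|r IH] rd.
  by rewrite big_seq1 subrr /norm1 big1 // => i _; rewrite mxE.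
have line : \sum_(z <- centered_ints N) q ^+ `|z|%N <= (1 + q) / (1 - q).
  rewrite big_cons big_cat !big_map /=.
  have -> : (1 + q) / (1 - q) = 1 + (q / (1 - q) + q / (1 - q)).
    by field; rewrite gt_eqF.
  have geo : \sum_(i <- iota 0 N) q ^+ i.+1 <= q / (1 - q).
    rewrite ler_pdivlMr // -[N in iota 0 N]subn0 -/(index_iota 0 N) big_mkord.
    under eq_bigr do rewrite exprS.
    rewrite -big_distrr /= -mulrA ler_piMr ?(ltW q0) //.
    by rewrite mulrC -opprB mulNr -subrX1 opprB lerBlDr lerDl exprn_ge0 // ltW //.
  by rewrite lerD2l lerD.
rewrite big_allpairs_dep exprS.
apply: le_trans (_ : _ <= (1 + q) / (1 - q) * \sum_(x <- box N r t) q ^+ norm1 (x - t)) _.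
  rewrite big_distrr /= big_seq [leRHS]big_seq; apply: ler_sum => x xb.
  apply: le_trans (ler_wpM2r (exprn_ge0 _ (ltW q0)) line).
  rewrite big_distrl /=; apply: ler_sum => z _; rewrite -exprD.
  rewrite (_ : norm1 _ = `|z| + norm1 (x - t)%R)%N // /norm1.
  pose j := Ordinal rd; rewrite (bigD1 j) //= [in RHS](bigD1 j) //=.
  have /eqP xj : x 0 j - t 0 j == 0.
    by have := mem_boxP (ltnW rd) xb j; rewrite ltnn mul0n leqn0 absz_eq0.
  rewrite !mxE axis_mulz eqxx addrAC xj add0r absz0 add0n; congr addn.
  by apply: eq_bigr => i ij; rewrite !mxE axis_mulz ifN ?addr0 //.
by rewrite ler_wpM2l ?IH ?(ltnW rd) // divr_ge0 ?(ltW q10) // addr_ge0 // ltW.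
Qed.

Lemma sum_checker {R : nzRingType} {d : nat} (s : seq (cell d)) (z : cell d)
    (w : cell d -> R) :
  uniq s -> z \in s -> \sum_(y <- s) (checker z y)%:R * w y = w z.
Proof.
move=> us zs; rewrite (bigD1_seq z) //= /checker eqxx mul1r big1 ?addr0 //.
by move=> y /negbTE ->; rewrite mul0r.
Qed.

(* The initial weight is infinite, so weights are compared on every finite set
   of cells containing all the cells used by the moves. *)
Lemma reachable_weight {R : realType} {d m k : nat} {q : R} {c : config d} (t : cell d) :
  0 < q < 1 -> \sum_(i < k) q ^+ i.+1 = 1 -> reachable m k c ->
  exists s : seq (cell d), forall s', uniq s' -> {subset s <= s'} ->
    \sum_(y <- s') (c y)%:R * q ^+ norm1 (y - t) <=
    m%:R * \sum_(y <- s') q ^+ norm1 (y - t).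
Proof.
move=> q01 qs; have /andP[q0 q1] := q01.
elim=> [|c1 c2 _ [s IH] [x [e [ue occ mv]]]].
  exists [::] => s' us' _; rewrite big_distrr /=; apply: ler_sum => y _.
  rewrite ler_wpM2r ?exprn_ge0 ?(ltW q0) // ler_nat /init_config.
  by case: ifP.
exists (s ++ [seq x + e *+ j | j <- iota 0 k.+1]) => s' us' sub.
have ss' : {subset s <= s'} by move=> y ys; apply: sub; rewrite mem_cat ys.
have xs' j : (j <= k)%N -> x + e *+ j \in s'.
  move=> jk; apply: sub; rewrite mem_cat; apply/orP; right.
  by apply: (map_f (fun j => x + e *+ j)); rewrite mem_iota.
apply: le_trans (IH s' us' ss').
have jumpE : \sum_(j < k) q ^+ norm1 (x + e *+ j - t) =
    \sum_(y <- s') ((\sum_(j < k) checker (x + e *+ j)%R y)%N)%:R * q ^+ norm1 (y - t).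
  under [RHS]eq_bigr do rewrite natr_sum mulr_suml.
  rewrite exchange_big /=; apply: eq_bigr => j _.
  by rewrite (sum_checker _ _ (fun y => q ^+ norm1 (y - t))) // xs' // ltnW.
(* Adding the weight of the jumped cells to both sides turns the truncated subtraction of the move
   into an addition. *)
rewrite -(lerD2r (\sum_(j < k) q ^+ norm1 (x + e *+ j - t))) {1}jumpE -big_split /=.
have -> : \sum_(y <- s') ((c2 y)%:R * q ^+ norm1 (y - t) +
    (\sum_(j < k) checker (x + e *+ j)%R y)%N%:R * q ^+ norm1 (y - t)) =
   \sum_(y <- s') (c1 y)%:R * q ^+ norm1 (y - t) + q ^+ norm1 (x + e *+ k - t).
  rewrite -(sum_checker _ _ (fun y => q ^+ norm1 (y - t)) us' (xs' k (leqnn k))).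
  rewrite -big_split /=; apply: eq_bigr => y _; rewrite -!mulrDl -!natrD.
  congr (_%:R * _); rewrite sum_checkers // mv /checker.
  case: existsP => [[j /eqP yj]|_] /=; last lia.
  by have := occ j; rewrite -yj; lia.
rewrite lerD2l [x + _ - t]addrAC; under eq_bigr do rewrite addrAC.
exact: weight_jump.
Qed.

Lemma reachable_le {R : realType} {d m k : nat} {c : config d} (t : cell d) :
  (2 <= k)%N -> reachable m k c ->
  (c t)%:R <= ((knacci R k + 1) / (knacci R k - 1)) ^+ d * m%:R.
Proof.
move=> k2 rc; have [_ /andP[p1 p2]] := knacciP R k2.
have p0 : 0 < knacci R k by apply: lt_trans p1.
set q := (knacci R k)^-1.
have q01 : 0 < q < 1 by rewrite invr_gt0 p0 invf_lt1.
have /andP[q0 q1] := q01.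
have [s hs] := reachable_weight t q01 (knacci_inv_sum k2) rc.
(* A crude radius: the sum of all distances to [t] bounds each of them. *)
pose N := (\sum_(y <- s) norm1 (y - t)%R)%N.
have sub : {subset s <= box N d t}.
  move=> y ys; apply/mem_boxP => // i; rewrite ltn_ord mul1n /N (big_rem y) //=.
  by rewrite /norm1 (bigD1 i) //= !mxE -addnA leq_addr.
have -> : (knacci R k + 1) / (knacci R k - 1) = (1 + q) / (1 - q).
  by rewrite /q; field; rewrite !gt_eqF // subr_gt0.
rewrite mulrC; have := hs _ (box_uniq N d t (leqnn d)) sub.
move=> h; apply: le_trans (le_trans h _); last first.
  by rewrite ler_wpM2l // sum_box_weight.
(* The cell [t] has weight 1 and all other terms are nonnegative. *)
rewrite (bigD1_seq t) ?box_uniq //=; last first.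
  by apply/mem_boxP => // i; rewrite subrr.
rewrite subrr (_ : norm1 0 = 0%N) ?mulr1 ?lerDl.
  by apply: sumr_ge0 => y _; rewrite mulr_ge0 // exprn_ge0 // ltW.
by rewrite /norm1 big1 // => i _; rewrite mxE.
Qed.

(** * Accumulated losses and conclusion *)

(** A telescoping sum: a loss incurred [i] steps before the last one is multiplied by [rho] in each
    of the [i] remaining steps. *)
Lemma iter_affine {R : comRingType} (rho : R) (u : nat -> R) (n : nat) :
  u n = rho ^+ n * u 0 - \sum_(i < n) rho ^+ i * (rho * u (n - i.+1)%N - u (n - i)%N).
Proof.
elim: n => [|n IH]; first by rewrite big_ord0 subr0 mul1r.
rewrite big_ord_recl mul1r subn0 subSS subn0.
under eq_bigr => i _ do rewrite lift0 subSS subSS exprS -mulrA.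
by rewrite -big_distrr /= exprS {1}IH; ring.
Qed.

Theorem theorem5 (R : realType) (d m k : nat)
    (hd : (1 <= d)%N) (hm : (1 <= m)%N) (hk : (2 <= k)%N) :
  let rho : R := (knacci R k + 1) / (knacci R k - 1) in
  (exists eps : 'I_d -> R,
     (forall i : 'I_d, 0 < eps i < 2) /\
     exists (c : config d) (x : cell d),
       reachable m k c /\
       rho ^+ d * m%:R - \sum_(i < d) rho ^+ i * eps i <= (c x)%:R) /\
  ~ (exists (c : config d) (x : cell d),
       reachable m k c /\ (Num.floor (rho ^+ d * m%:R) < (c x)%:Z)).
Proof.
move=> rho; split; last first.
  move=> [c [x [rc]]]; rewrite ltNge => /negP; apply.
  by rewrite floor_ge_int ?num_real // (reachable_le x hk rc).
pose M i : R := (iter i (gather R k) m)%:R.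
(* [eps i] is the loss of the gathering that is followed by [i] further ones, hence the reversed
   index. *)
exists (fun i : 'I_d => rho * M (d - i.+1)%N - M (d - i)%N); split=> [i|].
  rewrite -(subnSK (ltn_ord i)); apply: gather_loss => //.
  exact: iter_gather_gt0.
have [c [t [rc le]]] := reachable_gather (R := R) (d := d) hk hm.
by exists c, t; split=> //; rewrite -(iter_affine rho M) ler_nat.
Qed.
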